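(* Let $h:\mathbb{R}^n\to\mathbb{R}$ be twice differentiable and strongly convex, let $f:\mathbb{R}^n\to\mathbb{R}$ be differentiable, convex and $\sigma$-uniformly convex with respect to $h$ for some $\sigma\ge0$, and let $x^*$ be a minimizer of $f$. Let $\alpha,\delta,\eta,\nu$ be differentiable real functions on a time interval $I$ with initial time $t_0$, put $A(t)=\dot\delta(t)+\dot\eta(t)-\dot\alpha(t)-e^{\alpha(t)}$, and suppose that for all $t\in I$ $$\dot\nu(t)\le e^{\alpha(t)},\qquad -A(t)+[\dot\nu(t)+\dot\eta(t)]\le0,\qquad A(t)-\sigma e^{-\eta(t)+\alpha(t)}\le0,\qquad -A(t)\le0.$$ Let $(x(t),z(t))$ be a solution on $I$ of $$\begin{cases}\dot x(t)=e^{\alpha(t)}(z(t)-x(t)),\\ \nabla^2h(z(t))\,\dot z(t)=-A(t)\bigl[\nabla h(z(t))-\nabla h(x(t))\bigr]-e^{-\eta(t)+\alpha(t)}\nabla f(x(t)),\end{cases}$$ and let $V(t)=e^{\nu(t)}\bigl(e^{\eta(t)}\mathcal{D}_h(x^*,z(t))+[f(x(t))-f(x^* )]\bigr)$. If $I=[t_0,T]$ or $I=[t_0,+\infty)$, then for all $t\in I$ $$f(x(t))-f(x^* )\le e^{-\nu(t)}V(t_0),\qquad e^{\eta(t)}\mathcal{D}_h(x^*,z(t))\le e^{-\nu(t)}V(t_0).$$ If $I=[t_0,+\infty)$, then moreover $$\int_{t_0}^{+\infty}e^{\nu(t)+\eta(t)}\bigl(A(t)-[\dot\nu(t)+\dot\eta(t)]\bigr)\mathcal{D}_h(x^*,z(t))\,dt\le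 V(t_0),$$ $$\int_{t_0}^{+\infty}e^{\nu(t)+\eta(t)}\bigl(-A(t)+\sigma e^{-\eta(t)+\alpha(t)}\bigr)\mathcal{D}_h(x^*,x(t))\,dt\le V(t_0),$$ $$\int_{t_0}^{+\infty}e^{\nu(t)+\eta(t)}A(t)\,\mathcal{D}_h(z(t),x(t))\,dt\le V(t_0).$$
   Context: The Bregman divergence of a differentiable convex function $h$ is $\mathcal{D}_h(y,x)=h(y)-h(x)-\nabla h(x)^\top(y-x)$. A differentiable $f$ is $\sigma$-uniformly convex with respect to $h$ ($\sigma\ge0$) if $\mathcal{D}_f(y,x)\ge\sigma\mathcal{D}_h(y,x)$ for all $x,y$. A dot denotes $d/dt$. Note that $z(t)=x(t)+e^{-\alpha(t)}\dot x(t)$ by the first state equation. *)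

(* Defs.v *)
From HB Require Import structures.
From mathcomp Require Import all_boot all_order all_algebra.
From mathcomp Require Import all_classical all_reals all_analysis.

Set Implicit Arguments.
Unset Strict Implicit.
Unset Printing Implicit Defensive.

Import Order.TTheory GRing.Theory Num.Theory.
Import numFieldNormedType.Exports.

Local Open Scope classical_set_scope.
Local Open Scope ring_scope.

Section TimeDerivative.
Context {R : realType} {V : normedModType R}.
Implicit Types (I : set R) (u : R -> V) (t : R).

(* The difference quotient of [derivable] and [derive1], restricted to the
   increments that stay in [I]: this is the ordinary derivative at an interior
   point of [I] and the one-sided derivative at an endpoint that belongs to
   [I]. Values of [u] outside [I] play no role. *)
Definition derivable_in I u t : Prop :=
  cvg ((fun s : R => s^-1 *: (u (s + t) - u t)) @
       within [set s | I (s + t)] 0^').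

Definition derive_in I u t : V :=
  lim ((fun s : R => s^-1 *: (u (s + t) - u t)) @
       within [set s | I (s + t)] 0^').

End TimeDerivative.

Section ConvexAnalysis.
Context {R : realType} {n : nat}.
Implicit Types (g h : 'cV[R]_n -> R) (x y : 'cV[R]_n).

Definition dot x y : R := (x^T *m y) 0 0.

Definition grad g x : 'cV[R]_n := \col_i 'D_(delta_mx i 0) g x.

Definition hess g x : 'M[R]_n :=
  \matrix_(i, j) 'D_(delta_mx j 0) (fun y => 'D_(delta_mx i 0) g y) x.

Definition twice_differentiable g : Prop :=
  (forall x, differentiable g x) /\ (forall x, differentiable (grad g) x).

(* The norm of a matrix in the library is the sup norm, hence the squared
   Euclidean norm is written with [dot]. *)
Definition strongly_convex g : Prop :=
  exists2 mu : R, 0 < mu &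
    forall x y (l : R), 0 <= l <= 1 ->
      g (l *: x + (1 - l) *: y) <=
      l * g x + (1 - l) * g y
      - mu / 2 * (l * (1 - l)) * dot (x - y) (x - y).

Definition bregman h y x : R := h y - h x - dot (grad h x) (y - x).

Definition uniformly_convex (sigma : R) h g : Prop :=
  forall x y, sigma * bregman h y x <= bregman g y x.

Definition minimizer g x : Prop := forall y, g x <= g y.

End ConvexAnalysis.

Section Dynamics.
Context {R : realType} {n : nat}.
Implicit Types (I : set R) (alpha delta eta nu : R -> R).
Implicit Types (h f : 'cV[R]_n -> R) (x z : R -> 'cV[R]_n) (xs : 'cV[R]_n).

Definition damping I alpha delta eta (t : R) : R :=
  derive_in I delta t + derive_in I eta t - derive_in I alpha t
  - expR (alpha t).

Definition is_solution I h f alpha delta eta x z : Prop :=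
  forall t, I t ->
    [/\ derivable_in I x t,
        derivable_in I z t,
        derive_in I x t = expR (alpha t) *: (z t - x t) &
        hess h (z t) *m derive_in I z t =
          - damping I alpha delta eta t *: (grad h (z t) - grad h (x t))
          - expR (- eta t + alpha t) *: grad f (x t)].

Definition lyapunov h f xs eta nu x z (t : R) : R :=
  expR (nu t) *
  (expR (eta t) * bregman h xs (z t) + (f (x t) - f xs)).

End Dynamics.

(* Main.v *)
(* The Lyapunov function V is nonincreasing. By the dynamics and the three-point
   identity
     <grad h z - grad h x, xs - z> = D_h(xs, x) - D_h(xs, z) - D_h(z, x),
   the uniform convexity of f gives
     V' <= - (g1 + g2 + g3) - e^nu (e^alpha - nu') (f x - f xs),
   where g1, g2, g3 are the three integrands; the scaling conditions make every
   term on the right nonpositive. The pointwise bounds follow from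
   V t <= V t0, and each integral is at most the total decrease of V, which is
   at most V t0 since V >= 0. *)
Require Import Defs.
From HB Require Import structures.
From mathcomp Require Import all_boot all_order all_algebra.
From mathcomp Require Import all_classical all_reals all_analysis.
From mathcomp Require Import measurable_realfun ring lra.

Set Implicit Arguments.
Unset Strict Implicit.
Unset Printing Implicit Defensive.
Import Order.TTheory GRing.Theory Num.Theory.
Import numFieldNormedType.Exports.

Local Open Scope classical_set_scope.
Local Open Scope ring_scope.

(** * Chain rule along curves and integral bounds for monotone functions *)

Lemma is_derive_comp (R : realType) (V W : normedModType R) (g : V -> W)
    (y : R -> V) (t : R) (dy : V) :
  differentiable g (y t) -> is_derive t (1 : R) y dy ->
  is_derive t (1 : R) (g \o y) ('D_dy g (y t)).
Proof.
move=> dg [/derivable1_diffP dyt <-].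
have dgy : differentiable (g \o y) t by exact: differentiable_comp.
apply: DeriveDef; first exact/derivable1_diffP.
by rewrite !deriveE// diff_comp.
Qed.

(* The library's monotonicity lemma asks for measurability; the integral of a
   nonnegative function is a supremum over simple minorants, so it is monotone
   without it. *)
Lemma le_integral_ge0 d (T : measurableType d) (R : realType)
    (mu : {measure set T -> \bar R}) (D : set T) (f g : T -> \bar R) :
  (forall x, D x -> 0 <= f x)%E -> (forall x, D x -> f x <= g x)%E ->
  (\int[mu]_(x in D) f x <= \int[mu]_(x in D) g x)%E.
Proof.
move=> f0 fg; rewrite (integral_mkcond D f) (integral_mkcond D g).
have f0' x : (0 <= (f \_ D) x)%E by apply: erestrict_ge0.
have fg' x : ((f \_ D) x <= (g \_ D) x)%E by apply: lee_restrict.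
rewrite !ge0_integralTE//; last by move=> x; exact: le_trans (fg' x).
apply: ereal_sup_le => _ [k /= kf <-]; exists k => //= x.
exact: le_trans (kf x) (fg' x).
Qed.

(* With [F] a primitive of [U], the integrand is the derivative of
   [G t = (F (t + e) - F t) / e], which lies between [U t] and [U (t + e)]. *)
Lemma integral_growth_rate_le (R : realType) (U : R -> R) (a M e : R) :
  continuous U -> nondecreasing_fun U -> (forall t, U t <= M) -> 0 < e ->
  (\int[@lebesgue_measure R]_(t in `[a, +oo[%classic)
     (e^-1 * (U (t + e) - U t))%:E <= (M - U a)%:E)%E.
Proof.
move=> cU ndU UM e0.
(* Starting at [a - 1] makes [a] an interior point, so that [F] is differentiable at [a] as well. *)
pose F x := (\int[@lebesgue_measure R]_(t in `[a - 1, x]) U t)%R.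
have dF t : a - 1 < t -> is_derive t (1 : R) F (U t).
  move=> ta; have t1 : t < t + 1 by rewrite ltrDl.
  have iU : (@lebesgue_measure R).-integrable `[a - 1, t + 1] (EFin \o U).
    apply: continuous_compact_integrable; first exact: segment_compact.
    exact: continuous_subspaceT.
  have [dF <-] := continuous_FTC1_closed t1 iU ta (cU t).
  by rewrite derive1E; exact: derivableP.
pose G t := e^-1 * (F (t + e) - F t).
have dG t : a - 1 < t -> is_derive t (1 : R) G (e^-1 * (U (t + e) - U t)).
  move=> ta; have te : a - 1 < t + e by rewrite ltr_wpDr// ltW.
  have dFe : is_derive t (1 : R) (fun t => F (t + e)) (U (t + e)).
    have dFte : differentiable F (t + e).
      by apply/derivable1_diffP/(@ex_derive _ _ _ _ _ _ _ (dF _ te)).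
    have := @is_derive_comp _ _ _ F (shift e) t _ dFte
      (is_derive_shift t (1 : R) e).
    by rewrite (@derive_val _ _ _ _ _ _ _ (dF _ te)).
  exact: (is_deriveZ e^-1 (is_deriveB dFe (dF t ta))).
have GU t : a <= t -> U t <= G t <= U (t + e).
  move=> at_; have tte : t <= t + e by rewrite lerDl ltW.
  have a1t : a - 1 < t by lra.
  (* The mean value theorem gives [G t = U c] with [c] between [t] and [t + e]; monotonicity of [U]
     does the rest. *)
  have [||c] := @MVT_segment R F U t (t + e) tte.
  - by move=> x; rewrite in_itv/= => /andP[tx _]; apply: dF; lra.
  - apply: derivable_within_continuous => x; rewrite in_itv/= => /andP[tx _].
    by apply: (@ex_derive _ _ _ _ _ _ _ (dF x _)); lra.
  - rewrite in_itv/= => /andP[tc ce] FE.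
    have -> : G t = U c by rewrite /G FE; field; rewrite gt_eqF.
    by rewrite !ndU.
(* [U] tends to its supremum [l], and [G] is squeezed to the same limit, so the integral equals
   [l - G a], where [l <= M] and [U a <= G a]. *)
pose l := sup (range U).
have Ul : U t @[t --> +oo] --> l.
  by apply: nondecreasing_cvgr => //; exists M => _ [t _ <-].
have lM : l <= M.
  by apply: ge_sup => [|_ [t _ <-]//]; exists (U 0); exists 0.
have Gl : G t @[t --> +oo] --> l.
  apply: (@squeeze_cvgr _ _ _ _ U (fun t => U (t + e))) => //.
    by near=> t; apply: GU; near: t; exact/nbhs_pinfty_ge/num_real.
  rewrite /=.
  by apply: (@cvg_comp _ _ _ (fun t => t + e) U _ _ _ _ Ul); exact: cvg_addrr.
rewrite (@ge0_continuous_FTC2y R _ G a l)//.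
- have /andP[Ga _] := GU a (lexx a).
  by rewrite -EFinB lee_fin; lra.
- move=> t _; rewrite mulr_ge0 ?invr_ge0 ?(ltW e0)// subr_ge0 ndU//.
  by rewrite lerDl ltW.
- apply: continuous_subspaceT => t.
  apply: cvgM; [exact: cvg_cst|apply: cvgB; last exact: cU].
  apply: (@cvg_comp _ _ _ (fun t => t + e) U _ _ _ _ (cU _)).
  by apply: cvgD => //; exact: cvg_cst.
- by move=> t ta; apply: (@ex_derive _ _ _ _ _ _ _ (dG t _)); lra.
- apply: cvg_at_right_filter; apply: differentiable_continuous.
  by apply/derivable1_diffP/(@ex_derive _ _ _ _ _ _ _ (dG a _)); lra.
- move=> t; rewrite in_itv/= andbT => ta; rewrite derive1E.
  by apply: (@derive_val _ _ _ _ _ _ _ (dG t _)); lra.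
Unshelve. all: by end_near. Qed.

(* [W] is only differentiable, so its derivative need not be continuous or
   known to be integrable, and the fundamental theorem of calculus is not
   available; Fatou's lemma is applied to the difference quotients of [- W],
   extended by a constant to the left of [a]. *)
Lemma integral_le_of_derive_le (R : realType) (W g : R -> R) (a : R) :
  {within `[a, +oo[, continuous W} ->
  (forall t, a <= t -> 0 <= W t) ->
  (forall t, a <= t -> 0 <= g t) ->
  (forall t, a < t -> derivable W t 1) ->
  (forall t, a < t -> g t <= - 'D_1 W t) ->
  (\int[@lebesgue_measure R]_(t in `[a, +oo[%classic) (g t)%:E
     <= (W a)%:E)%E.
Proof.
move=> cW W0 g0 dW gW.
have niW s t : a <= s -> s <= t -> W t <= W s.
  apply: ler0_derive1_nincry => // u; rewrite in_itv/= andbT => au.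
    exact: dW.
  by rewrite derive1E -oppr_ge0 (le_trans _ (gW _ au))// g0// ltW.
pose U t := - W (Num.max t a).
have cU : continuous U.
  move=> t; apply: cvgN.
  (* The map [Num.max _ a] is continuous with values in [[a, +oo[], so continuity of [W] within that
     half-line yields full continuity of [U]. *)
  have aM : `[a, +oo[%classic (Num.max t a).
    by rewrite /= in_itv/= andbT le_max lexx orbT.
  apply: cvg_comp (proj1 (subspace_continuousP _ _) cW _ aM) => P /= PW.
  have cM : {for t, continuous (fun s : R => Num.max s a)}.
    by apply: continuous_max; [exact: cvg_id|exact: cvg_cst].
  near=> s; suff : `[a, +oo[%classic (Num.max s a) -> P (Num.max s a).
    by apply; rewrite /= in_itv/= andbT le_max lexx orbT.
  by near: s; exact: (cM _ PW).
have ndU : nondecreasing_fun U.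
  move=> s t st; rewrite lerN2; apply: niW.
    by rewrite le_max lexx orbT.
  by rewrite ge_max !le_max st lexx orbT.
have U0 t : U t <= 0 by rewrite oppr_le0 W0// le_max lexx orbT.
(* Forward difference quotients of [U] with step [1 / (n + 1)]. *)
pose q n t : R := n.+1%:R * (U (t + n.+1%:R^-1) - U t).
have q0 n t : 0 <= q n t.
  by rewrite mulr_ge0// subr_ge0 ndU// lerDl invr_ge0.
have mq n : measurable_fun [set: R] (q n).
  apply: continuous_measurable_fun => t.
  apply: cvgM; [exact: cvg_cst|apply: cvgB; last exact: cU].
  apply: (@cvg_comp _ _ _ (fun t => t + n.+1%:R^-1) U _ _ _ _ (cU _)).
  by apply: cvgD => //; exact: cvg_cst.
have mqE n : measurable_fun `]a, +oo[ (fun t => (q n t)%:E).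
  by apply/measurable_EFinP; exact: measurable_funTS.
have qW t : a < t -> q n t @[n --> \oo] --> - 'D_1 W t.
  move=> at_.
  have -> : q^~ t = fun n => - ((@harmonic R n)^-1 *:
      (W (@harmonic R n *: 1 + t) - W t)).
    apply/funext => n; rewrite /q /U /harmonic/= invrK !max_l ?(ltW at_)//.
      by rewrite [_%:A]mulr1 -mulrN opprB opprK addrC (addrC t).
    by rewrite (le_trans (ltW at_))// lerDl.
  apply: cvgN; have /cvg_dnbhs_at_right/cvg_at_rightP := dW _ at_.
  by apply; split; [move=> n; exact: harmonic_gt0|exact: cvg_harmonic].
have qWE t : a < t -> (q n t)%:E @[n --> \oo] --> (- 'D_1 W t)%:E.
  by move=> at_; apply: cvg_EFin; [by apply: nearW|exact: qW].
(* The derivative bound holds only for [t > a]; the value [g a] keeps [L] above [g] at [a], a null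
   set that is then removed from the domain. On the open half-line [L] is measurable as a pointwise
   limit of the [q n]. *)
pose L t : \bar R := if t == a then (g a)%:E else (- 'D_1 W t)%:E.
have mL : measurable_fun `]a, +oo[ L.
  apply: (@emeasurable_fun_cvg _ _ _ _ (fun n t => (q n t)%:E)).
    exact: mqE.
  move=> t /=; rewrite in_itv/= andbT => at_.
  by rewrite /L gt_eqF//; exact: qWE.
apply: (@le_trans _ _ (\int[@lebesgue_measure R]_(t in `[a, +oo[) L t)%E).
  apply: le_integral_ge0 => t /=; rewrite in_itv/= andbT => at_.
    by rewrite lee_fin g0.
  rewrite /L; case: eqP => [->//|/eqP ta].
  by rewrite lee_fin gW// lt_neqAle eq_sym ta.
rewrite -integral_itv_obnd_cbnd//.
have -> : (\int[@lebesgue_measure R]_(t in `]a, +oo[) L t =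
    \int[@lebesgue_measure R]_(t in `]a, +oo[)
      limn_einf (fun n => (q n t)%:E))%E.
  apply: eq_integral => t; rewrite inE/= in_itv/= andbT => at_.
  by rewrite /L gt_eqF// (cvg_limn_einf_sup (qWE _ at_)).1.
apply: (@le_trans _ _ (limn_einf (fun n =>
    \int[@lebesgue_measure R]_(t in `]a, +oo[) (q n t)%:E)%E)).
  apply: fatou => //.
  by move=> n t _; rewrite lee_fin.
(* Each tail infimum is at most its first term, and every integral of [q n] is at most [W a], by the
   growth rate bound with [M = 0] and [U a = - W a]. *)
rewrite limn_einf_lim; apply: lime_le; first exact: is_cvg_einfs.
apply: nearW => n; apply: (@le_trans _ _
    (\int[@lebesgue_measure R]_(t in `]a, +oo[) (q n t)%:E)%E).
  by apply: ereal_inf_lbound; exists n => /=.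
rewrite integral_itv_obnd_cbnd; last exact: mqE.
have n0 : 0 < n.+1%:R^-1 :> R by rewrite invr_gt0.
have := integral_growth_rate_le a cU ndU U0 n0.
by rewrite invrK sub0r /U opprK maxxx.
Unshelve. all: by end_near. Qed.

(** * Derivatives relative to the time interval *)

Lemma derivable_in_interior (R : realType) (V : normedModType R) (I : set R)
    (u : R -> V) (t : R) :
  nbhs t I -> derivable_in I u t -> is_derive t (1 : R) u (derive_in I u t).
Proof.
move=> It.
have I0 : \forall s \near (0 : R)^', I (s + t).
  apply: nbhs_dnbhs; have : s + t @[s --> (0 : R)] --> t.
    by rewrite -[X in _ --> X]add0r; apply: cvgD => //; exact: cvg_cst.
  exact.
(* Small increments all stay in [I], so the restricted filter is the usual punctured one. *)
have FE : within [set s | I (s + t)] (0 : R)^' = (0 : R)^'.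
  rewrite eqEsubset; split => P; last exact: cvg_within.
  by apply: filterS2 I0 => s Is; apply.
have qE : (fun s : R => s^-1 *: (u (s + t) - u t)) =
    (fun s : R => s^-1 *: ((u \o shift t) (s *: 1) - u t)).
  by apply/funext => s /=; rewrite [s *: 1]mulr1.
by rewrite /derivable_in /derive_in FE qE => du; exact: DeriveDef.
Qed.

(** Near [t] the difference quotient is within 1 of its limit [l], hence
    [|u s - u t| <= (1 + |l|) |s - t|] for [s] in [I]. *)
Lemma derivable_in_within_continuous (R : realType) (V : normedModType R)
    (I : set R) (u : R -> V) :
  (forall t, I t -> derivable_in I u t) -> {within I, continuous u}.
Proof.
move=> du; apply/subspace_continuousP => t It.
have /cvg_ex[l /cvgrPdist_le /(_ 1 ltr01)] := du t It.
rewrite near_withinE /dnbhs near_withinE => ul.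
apply/cvgrPdist_le => e e0.
have c0 : s - t @[s --> t] --> (0 : R).
  by rewrite -(subrr t); apply: cvgB => //; exact: cvg_cst.
have {}ul := c0 _ ul; rewrite near_withinE; near=> s => Is.
have [->|st] := eqVneq s t; first by rewrite subrr normr0 ltW.
have h : `|l - (s - t)^-1 *: (u s - u t)| <= 1.
  have : (s - t != 0) -> I (s - t + t) ->
      `|l - (s - t)^-1 *: (u (s - t + t) - u t)| <= 1 by near: s.
  by rewrite subrK subr_eq0; apply.
have ut : `|(s - t)^-1 *: (u s - u t)| <= 1 + `|l|.
  by rewrite -lerBlDr (le_trans _ h)// distrC lerB_dist.
rewrite normrZ normfV ler_pdivrMl ?normr_gt0 ?subr_eq0// in ut.
rewrite distrC (le_trans ut)// -ler_pdivlMr ?ltr_pwDl//.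
rewrite distrC; near: s; apply: cvgr_dist_le; first exact: cvg_id.
by rewrite divr_gt0// ltr_pwDl.
Unshelve. all: by end_near. Qed.

(** * Calculus of gradients, Hessians and Bregman divergences *)

Lemma differentiable_dirE (R : realType) (n : nat) (W : normedModType R)
    (g : 'cV[R]_n -> W) (x v : 'cV[R]_n) :
  differentiable g x ->
  'D_v g x = \sum_i v i 0 *: 'D_(delta_mx i 0) g x.
Proof.
move=> dg; rewrite deriveE// {1}(matrix_sum_delta v) linear_sum.
apply: eq_bigr => i _; rewrite big_ord1 linearZ deriveE//.
Qed.

Lemma derive_dot_grad (R : realType) (n : nat) (g : 'cV[R]_n -> R)
    (x v : 'cV[R]_n) : differentiable g x -> 'D_v g x = dot (grad g x) v.
Proof.
move=> dg; rewrite differentiable_dirE// /dot mxE; apply: eq_bigr => i _.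
by rewrite !mxE mulrC.
Qed.

(** Turns the chain rule for [grad h] along [z] into the left-hand side of the second state
    equation. *)
Lemma derive_grad (R : realType) (n : nat) (g : 'cV[R]_n -> R)
    (x v : 'cV[R]_n) :
  differentiable (grad g) x -> 'D_v (grad g) x = hess g x *m v.
Proof.
move=> dg; rewrite differentiable_dirE//; apply/colP => i.
rewrite !mxE summxE; apply: eq_bigr => j _.
rewrite mxE mulrC derive_mx; last exact: diff_derivable.
rewrite [in LHS]mxE [in RHS]mxE; congr (_ * _).
have -> : (fun y => grad g y i 0) = (fun y => 'D_(delta_mx i 0) g y) => [|//].
by apply/funext => y; rewrite mxE.
Qed.

Lemma is_derive_dot (R : realType) (n : nat) (u v : R -> 'cV[R]_n)
    (du dv : 'cV[R]_n) (t : R) :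
  is_derive t (1 : R) u du -> is_derive t (1 : R) v dv ->
  is_derive t (1 : R) (fun s => dot (u s) (v s)) (dot du (v t) + dot (u t) dv).
Proof.
move=> [du1 <-] [dv1 <-].
have cu i : is_derive t (1 : R) (fun s => u s i 0) ('D_1 u t i 0).
  have -> : 'D_1 u t i 0 = 'D_1 (fun s => u s i 0) t.
    by rewrite (derive_mx du1) mxE.
  apply: derivableP; exact: (proj1 (derivable_mxP u t 1) du1 i 0).
have cv i : is_derive t (1 : R) (fun s => v s i 0) ('D_1 v t i 0).
  have -> : 'D_1 v t i 0 = 'D_1 (fun s => v s i 0) t.
    by rewrite (derive_mx dv1) mxE.
  apply: derivableP; exact: (proj1 (derivable_mxP v t 1) dv1 i 0).
have -> : (fun s => dot (u s) (v s)) =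
    \sum_(i < n) ((fun s => u s i 0) * (fun s => v s i 0)).
  apply/funext => s; rewrite fct_sumE /dot mxE.
  by apply: eq_bigr => i _; rewrite mxE.
apply: is_derive_eq.
rewrite /dot !mxE -big_split/=; apply: eq_bigr => i _; rewrite !mxE.
by rewrite addrC /GRing.scale/= [in X in _ + X]mulrC.
Qed.

(** Convexity bounds the slopes of [g] from [x] towards [y] by [g y - g x]; as the step tends to 0
    from the right, they tend to the directional derivative [dot (grad g x) (y - x)]. *)
Lemma bregman_ge0 (R : realType) (n : nat) (g : 'cV[R]_n -> R)
    (y x : 'cV[R]_n) :
  strongly_convex g -> differentiable g x -> 0 <= bregman g y x.
Proof.
move=> [mu mu0 gc] dg.
have dotge0 (v : 'cV[R]_n) : 0 <= dot v v.
  by rewrite /dot mxE sumr_ge0// => i _; rewrite mxE -expr2 sqr_ge0.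
have gl l : 0 < l <= 1 -> l^-1 * (g (l *: (y - x) + x) - g x) <= g y - g x.
  move=> /andP[l0 l1]; rewrite mulrC ler_pdivrMr//.
  have := gc y x l; rewrite (ltW l0) l1 => /(_ isT).
  have -> : l *: y + (1 - l) *: x = l *: (y - x) + x.
    by rewrite scalerBl scalerBr scale1r addrCA addrC.
  move=> h; rewrite lerBlDr (le_trans h)//.
  have : 0 <= mu / 2 * (l * (1 - l)) * dot (y - x) (y - x).
    by rewrite !mulr_ge0// ?invr_ge0 ?subr_ge0// ltW.
  nra.
rewrite /bregman -derive_dot_grad// subr_ge0 /derive.
have /cvg_dnbhs_at_right := @diff_derivable _ _ _ g x (y - x) dg.
move=> c.
apply: (cvgr_to_le c).
near=> l; apply: gl; apply/andP; split.
  by near: l; exact: nbhs_right_gt.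
by near: l; apply: nbhs_right_le.
Unshelve. all: by end_near. Qed.

Lemma is_derive_expR_comp (R : realType) (u : R -> R) (t du : R) :
  is_derive t (1 : R) u du ->
  is_derive t (1 : R) (fun s => expR (u s)) (expR (u t) * du).
Proof.
move=> dut; have de : differentiable (@expR R) (u t).
  exact/derivable1_diffP/derivable_expR.
have := is_derive_comp de dut.
rewrite -[X in 'D_X _ _]mulr1 -[X in 'D_X _ _]/(du *: 1) deriveE// linearZ.
by rewrite -deriveE// derive_val mulrC.
Qed.

Lemma dotDl (R : realType) (n : nat) (u v w : 'cV[R]_n) :
  dot (u + v) w = dot u w + dot v w.
Proof. by rewrite /dot linearD mulmxDl mxE. Qed.

Lemma dotDr (R : realType) (n : nat) (u v w : 'cV[R]_n) :
  dot w (u + v) = dot w u + dot w v.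
Proof. by rewrite /dot mulmxDr mxE. Qed.

Lemma dotZl (R : realType) (n : nat) (a : R) (u v : 'cV[R]_n) :
  dot (a *: u) v = a * dot u v.
Proof. by rewrite /dot linearZ -scalemxAl mxE. Qed.

Lemma dotZr (R : realType) (n : nat) (a : R) (u v : 'cV[R]_n) :
  dot u (a *: v) = a * dot u v.
Proof. by rewrite /dot -scalemxAr mxE. Qed.

Lemma dotNl (R : realType) (n : nat) (u v : 'cV[R]_n) :
  dot (- u) v = - dot u v.
Proof. by rewrite -scaleN1r dotZl mulN1r. Qed.

Lemma dotNr (R : realType) (n : nat) (u v : 'cV[R]_n) :
  dot u (- v) = - dot u v.
Proof. by rewrite -scaleN1r dotZr mulN1r. Qed.

(** The terms [dot (grad h (z t)) dz] coming from [h (z s)] and from [y - z s] cancel, leaving only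
    the Hessian term. *)
Lemma is_derive_bregman (R : realType) (n : nat) (h : 'cV[R]_n -> R)
    (y : 'cV[R]_n) (z : R -> 'cV[R]_n) (t : R) (dz : 'cV[R]_n) :
  differentiable h (z t) -> differentiable (grad h) (z t) ->
  is_derive t (1 : R) z dz ->
  is_derive t (1 : R) (fun s => bregman h y (z s))
    (- dot (hess h (z t) *m dz) (y - z t)).
Proof.
move=> dh dgh dzt.
have dhz : is_derive t (1 : R) (h \o z) (dot (grad h (z t)) dz).
  by have := is_derive_comp dh dzt; rewrite derive_dot_grad.
have dghz : is_derive t (1 : R) (grad h \o z) (hess h (z t) *m dz).
  by have := is_derive_comp dgh dzt; rewrite derive_grad.
have dyz : is_derive t (1 : R) (fun s => y - z s) (- dz).
  by have := is_deriveB (is_derive_cst y t (1 : R)) dzt; rewrite sub0r.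
have := is_deriveB (is_deriveB (is_derive_cst (h y) t (1 : R)) dhz)
  (is_derive_dot dghz dyz).
by rewrite dotNr /= sub0r opprD opprK addrCA addNr addr0.
Qed.

(** * Dissipation and continuity of the Lyapunov function *)

Lemma lyapunov_dissipation (R : realType) (n : nat) (h f : 'cV[R]_n -> R)
    (sigma : R) (xs : 'cV[R]_n) (I : set R) (alpha delta eta nu : R -> R)
    (x z : R -> 'cV[R]_n) (t : R) :
  let A := damping I alpha delta eta in
  let V := lyapunov h f xs eta nu x z in
  twice_differentiable h -> (forall y, differentiable f y) ->
  uniformly_convex sigma h f -> minimizer f xs -> nbhs t I ->
  derivable_in I eta t -> derivable_in I nu t ->
  derive_in I nu t <= expR (alpha t) ->
  is_solution I h f alpha delta eta x z ->
  derivable V t 1 /\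
  expR (nu t + eta t) * (A t - (derive_in I nu t + derive_in I eta t)) *
    bregman h xs (z t) +
  expR (nu t + eta t) * (- A t + sigma * expR (- eta t + alpha t)) *
    bregman h xs (x t) +
  expR (nu t + eta t) * A t * bregman h (z t) (x t) <= - 'D_1 V t.
Proof.
move=> A V [dh dgh] df fu fmin It deta dnu nua sol.
have {sol} [dx dz xE zE] := sol t (nbhs_singleton It).
have {}dx := derivable_in_interior It dx.
have {}dz := derivable_in_interior It dz.
have {}deta := derivable_in_interior It deta.
have {}dnu := derivable_in_interior It dnu.
have dfx : is_derive t (1 : R) (f \o x) (dot (grad f (x t)) (derive_in I x t)).
  by have := is_derive_comp (df (x t)) dx; rewrite derive_dot_grad.
have := is_deriveM (is_derive_expR_comp dnu) (is_deriveD
  (is_deriveM (is_derive_expR_comp deta)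
     (is_derive_bregman xs (dh (z t)) (dgh (z t)) dz))
  (is_deriveB dfx (is_derive_cst (f xs) t (1 : R)))).
rewrite -[X in is_derive _ _ X _]/V xE zE => -[dV VE].
split=> //; rewrite {}VE /GRing.scale/= -/A !fctE.
have := fu (x t) xs; have := fmin (x t).
(* Splitting at [z t] expresses all inner products through the same few scalars, so that the claim
   becomes a polynomial identity plus signs. *)
have split_dot u : dot u (xs - x t) = dot u (xs - z t) + dot u (z t - x t).
  by rewrite -dotDr addrA subrK.
rewrite /bregman !split_dot dotZr.
rewrite [dot (_ - _) _]dotDl dotNl dotZl dotDl !dotNl dotZl.
rewrite [expR (nu t + eta t)]expRD.
move: nua (expR_gt0 (nu t)) (expR_gt0 (eta t)) (expR_gt0 (- eta t + alpha t)).
(* With this factorization the exponentials can be generalized to independent positive reals [N],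
   [E], [K]. *)
have -> : expR (alpha t) = expR (eta t) * expR (- eta t + alpha t).
  by rewrite -expRD addNKr.
move: (expR (nu t)) (expR (eta t)) (expR (- eta t + alpha t)) => N E K.
move: (A t) (derive_in I nu t) (derive_in I eta t) => a dn de.
move: (dot (grad h (z t)) _) (dot (grad h (x t)) _) (dot (grad h (x t)) _)
  (dot (grad f (x t)) _) (dot (grad f (x t)) _) => p1 p2 p3 q1 q2.
move: (h _) (h _) (h _) (f _) (f _) => h1 h2 h3 f1 f2 dnK N0 E0 K0 f12 fh.
(* Here [E * K] is [expR (alpha t)], and what remains after the three-point
   identity is a sum of two terms with evident signs. *)
rewrite -subr_ge0 (_ : _ - _ = N * ((E * K - dn) * (f1 - f2) +
    E * K * (f2 - f1 - (q2 + q1) - sigma * (h3 - h2 - (p3 + p2)))));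
  last by ring.
by rewrite mulr_ge0 ?(ltW N0)// addr_ge0// !mulr_ge0 ?subr_ge0
  ?(ltW E0) ?(ltW K0).
Qed.

Lemma continuous_bregman (R : realType) (n : nat) (h : 'cV[R]_n -> R)
    (y : 'cV[R]_n) :
  twice_differentiable h -> continuous (bregman h y).
Proof.
move=> [dh dgh] v.
have ch : {for v, continuous h} by exact: differentiable_continuous.
have cgh : {for v, continuous (grad h)} by exact: differentiable_continuous.
have chv : h y - h w @[w --> v] --> h y - h v by exact: (cvgB (cvg_cst _) ch).
apply: (cvgB chv); rewrite /dot.
have cgi i : 'D_(delta_mx i 0) h w @[w --> v] --> 'D_(delta_mx i 0) h v.
  have giE w : grad h w i 0 = 'D_(delta_mx i 0) h w by rewrite mxE.
  rewrite -giE -(funext giE).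
  exact: (@continuous_comp _ _ _ (grad h) (fun M : 'cV[R]_n => M i 0) v cgh
    (@coord_continuous _ _ _ i 0 (grad h v))).
have cyi i : y i 0 - (w : 'cV[R]_n) i 0 @[w --> v] --> y i 0 - v i 0.
  have ci : (w : 'cV[R]_n) i 0 @[w --> v] --> (v : 'cV[R]_n) i 0.
    exact: (@coord_continuous _ _ _ i 0 v).
  exact: (cvgB (cvg_cst (y i 0)) ci).
have dotE w : ((grad h w)^T *m (y - w)) 0 0 =
    \sum_i 'D_(delta_mx i 0) h w * (y i 0 - w i 0).
  by rewrite mxE; apply: eq_bigr => i _; rewrite !mxE.
rewrite dotE (funext dotE).
apply: cvg_big => [|i _]; first exact: add_continuous.
exact: (cvgM (cgi i) (cyi i)).
Qed.

Lemma within_continuous_comp (S T U : topologicalType) (D : set S)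
    (u : S -> T) (g : T -> U) :
  continuous g -> {within D, continuous u} ->
  {within D, continuous (fun s => g (u s))}.
Proof.
move=> cg cu s.
exact: (@continuous_comp (subspace D) T U u g s (cu s) (cg (u s))).
Qed.

(** The dissipation estimate concerns interior times only; continuity carries the monotonicity of
    [V] to the endpoints of [I]. *)
Lemma lyapunov_within_continuous (R : realType) (n : nat)
    (h f : 'cV[R]_n -> R) (xs : 'cV[R]_n) (I : set R) (eta nu : R -> R)
    (x z : R -> 'cV[R]_n) :
  twice_differentiable h -> (forall y, differentiable f y) ->
  {within I, continuous eta} -> {within I, continuous nu} ->
  {within I, continuous x} -> {within I, continuous z} ->
  {within I, continuous (lyapunov h f xs eta nu x z)}.
Proof.
move=> d2h df ceta cnu cx cz.
have cf : continuous f by move=> y; exact: differentiable_continuous.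
have /subspace_continuousP cen :=
  within_continuous_comp (@continuous_expR R) cnu.
have /subspace_continuousP cee :=
  within_continuous_comp (@continuous_expR R) ceta.
have /subspace_continuousP cb :=
  within_continuous_comp (continuous_bregman (y := xs) d2h) cz.
have /subspace_continuousP cfx := within_continuous_comp cf cx.
apply/subspace_continuousP => t It.
exact: (cvgM (cen t It) (cvgD (cvgM (cee t It) (cb t It))
  (cvgB (cfx t It) (cvg_cst (f xs))))).
Qed.

(** * Pointwise decay and integral bounds *)

Theorem theorem3 (R : realType) (n : nat)
    (h f : 'cV[R]_n -> R) (sigma : R) (xs : 'cV[R]_n)
    (t0 : R) (I : set R) (alpha delta eta nu : R -> R)
    (x z : R -> 'cV[R]_n)
    (h_diff2 : twice_differentiable h)
    (h_strong : strongly_convex h)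
    (f_diff : forall y : 'cV[R]_n, differentiable f y)
    (f_convex : convex_function [set: 'cV[R]_n] f)
    (sigma_ge0 : 0 <= sigma)
    (f_unif : uniformly_convex sigma h f)
    (xs_min : minimizer f xs)
    (I_itv : (exists2 T : R, t0 < T & I = `[t0, T]%classic) \/
             I = `[t0, +oo[%classic)
    (alpha_diff : forall t : R, I t -> derivable_in I alpha t)
    (delta_diff : forall t : R, I t -> derivable_in I delta t)
    (eta_diff : forall t : R, I t -> derivable_in I eta t)
    (nu_diff : forall t : R, I t -> derivable_in I nu t)
    (scaling : forall t : R, I t ->
       let A := damping I alpha delta eta t in
       let dnu := derive_in I nu t in
       let deta := derive_in I eta t in
       [/\ dnu <= expR (alpha t),
           - A + (dnu + deta) <= 0,
           A - sigma * expR (- eta t + alpha t) <= 0 &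
           - A <= 0])
    (xz_sol : is_solution I h f alpha delta eta x z) :
  let A := damping I alpha delta eta in
  let V := lyapunov h f xs eta nu x z in
  (forall t : R, I t ->
     f (x t) - f xs <= expR (- nu t) * V t0 /\
     expR (eta t) * bregman h xs (z t) <= expR (- nu t) * V t0) /\
  (I = `[t0, +oo[%classic ->
   [/\ (\int[@lebesgue_measure R]_(t in `[t0, +oo[%classic)
          (expR (nu t + eta t) *
           (A t - (derive_in I nu t + derive_in I eta t)) *
           bregman h xs (z t))%:E <= (V t0)%:E)%E,
       (\int[@lebesgue_measure R]_(t in `[t0, +oo[%classic)
          (expR (nu t + eta t) *
           (- A t + sigma * expR (- eta t + alpha t)) *
           bregman h xs (x t))%:E <= (V t0)%:E)%E &
       (\int[@lebesgue_measure R]_(t in `[t0, +oo[%classic)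
          (expR (nu t + eta t) * A t *
           bregman h (z t) (x t))%:E <= (V t0)%:E)%E]).
Proof.
move=> A V.
have [dh dgh] := h_diff2.
have B0 u v : 0 <= bregman h u v by exact: bregman_ge0.
have fx0 t : 0 <= f (x t) - f xs by rewrite subr_ge0 xs_min.
have cV : {within I, continuous V}.
  apply: lyapunov_within_continuous => //.
  - exact: derivable_in_within_continuous.
  - exact: derivable_in_within_continuous.
  - by apply: derivable_in_within_continuous => t /xz_sol[].
  - by apply: derivable_in_within_continuous => t /xz_sol[].
have V0 t : 0 <= V t.
  by rewrite mulr_ge0 ?expR_ge0// addr_ge0// mulr_ge0// expR_ge0.
pose g1 t := expR (nu t + eta t) *
  (A t - (derive_in I nu t + derive_in I eta t)) * bregman h xs (z t).
pose g2 t := expR (nu t + eta t) *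
  (- A t + sigma * expR (- eta t + alpha t)) * bregman h xs (x t).
pose g3 t := expR (nu t + eta t) * A t * bregman h (z t) (x t).
(* The last three scaling conditions give the signs of the coefficients of [g1], [g2], [g3], in this
   order. *)
have g_ge0 t : I t -> [/\ 0 <= g1 t, 0 <= g2 t & 0 <= g3 t].
  move=> /scaling /= [_ s1 s2 s3]; rewrite -/A in s1 s2 s3.
  split; rewrite mulr_ge0// mulr_ge0 ?expR_ge0//; lra.
have dV t : nbhs t I -> derivable V t 1 /\ g1 t + g2 t + g3 t <= - 'D_1 V t.
  move=> It; have It' := nbhs_singleton It.
  have [s0 _ _ _] := scaling t It'.
  by apply: (lyapunov_dissipation h_diff2 f_diff f_unif xs_min It _ _ _ xz_sol);
    auto.
have V_le t : I t -> V t <= V t0.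
  move=> It.
  (* Both shapes of [I] are reduced to the same facts; [t] may be the right endpoint of [I], so only
     the open interval is claimed to be interior. *)
  have [t0t tI oI] : [/\ t0 <= t, `[t0, t] `<=` I &
      forall s, s \in `]t0, t[ -> nbhs s I].
    have oW s : t0 < s < t -> nbhs s (`]t0, t[%classic : set R).
      by move=> st; apply: near_in_itvoo; rewrite in_itv.
    move: It; case: I_itv => [[T t0T]|] IE; rewrite IE /= in_itv/= ?andbT.
      move=> /andP[t0t tT]; split=> // s; rewrite ?/= in_itv/=.
        by move=> /andP[t0s st]; rewrite in_itv/= t0s (le_trans st).
      move=> /oW; apply: filterS => r /=; rewrite !in_itv/=.
      by move=> /andP[/ltW-> /ltW rt]; exact: le_trans tT.
    move=> t0t; split=> // s; rewrite ?/= in_itv/=.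
      by move=> /andP[t0s _]; rewrite in_itv/= t0s.
    move=> /oW; apply: filterS => r /=; rewrite !in_itv/=.
    by move=> /andP[/ltW-> _].
  have := @ler0_derive1_le_cc R V t0 t; apply => //.
  - by move=> s /oI /dV[].
  - move=> s st; have [_] := dV _ (oI _ st).
    have [] := g_ge0 _ (nbhs_singleton (oI _ st)).
    by rewrite derive1E; lra.
  - exact: (continuous_subspaceW tI cV).
  - by rewrite in_itv/= t0t lexx.
  - by rewrite in_itv/= lexx.
split=> [t It|IE].
  (* Both summands on the right are nonnegative, so each is at most the whole, which is at most
     [expR (- nu t) * V t0]. *)
  have eV : expR (- nu t) * V t =
      expR (eta t) * bregman h xs (z t) + (f (x t) - f xs).
    by rewrite /V /lyapunov mulrA -expRD addNr expR0 mul1r.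
  have Ve : expR (- nu t) * V t <= expR (- nu t) * V t0.
    by rewrite ler_pM2l ?expR_gt0// V_le.
  split; apply: le_trans Ve; rewrite eV.
    by rewrite lerDr mulr_ge0// expR_ge0.
  by rewrite lerDl.
have It t : t0 <= t -> I t by rewrite IE /= in_itv/= andbT.
have oI t : t0 < t -> nbhs t I.
  move=> t0t; rewrite IE; apply: filterS (lt_nbhsr t0t) => s /= /ltW.
  by rewrite in_itv/= andbT.
(* Since the three integrands are nonnegative, each lies below their sum and hence below [- 'D_1 V];
   one statement serves all three integrals. *)
have main g : (forall t, I t -> 0 <= g t <= g1 t + g2 t + g3 t) ->
    (\int[@lebesgue_measure R]_(t in `[t0, +oo[%classic) (g t)%:E
       <= (V t0)%:E)%E.
  move=> gI; apply: integral_le_of_derive_le => //.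
  - by rewrite -IE.
  - by move=> t /It/gI/andP[].
  - by move=> t /oI/dV[].
  - move=> t /oI oIt; have /andP[_ gt] := gI t (nbhs_singleton oIt).
    by apply: le_trans gt _; have [] := dV t oIt.
split; [apply: (main g1)|apply: (main g2)|apply: (main g3)] => t /g_ge0[];
  lra.
Qed.
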